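(* Let $X\subseteq[0,\infty)^k$ be an infinite discrete additive semigroup with $0\in X$. Let $d\in\mathbb{N}$ and $a_0,a_1,\ldots,a_d\in\mathscr{A}_\infty$ with $a_d\neq0$, and put $$Tg=a_d*g^{*d}+a_{d-1}*g^{*(d-1)}+\cdots+a_1*g+a_0\qquad(g\in\mathscr{A}).$$ If $z_0\in\mathbb{C}$ is a simple zero of the polynomial $$f(z)=a_d(0)z^d+a_{d-1}(0)z^{d-1}+\cdots+a_1(0)z+a_0(0)\in\mathbb{C}[z],$$ then there exists a solution $g\in\mathscr{A}_\infty$ to $Tg=0$ satisfying $g(0)=z_0$.
   Context: Here $k\in\mathbb{N}=\{1,2,\ldots\}$. $X$ is a subset of $[0,\infty)^k$ closed under addition; ''discrete'' means $X$ has no cluster point in $\mathbb{R}^k$ (so $X$ is countable). The Dirichlet algebra $\mathscr{A}=\mathbb{C}^X$ is the commutative complex algebra of all functions $g\colon X\to\mathbb{C}$ with the usual linear operations and convolution $$(g*h)(x)=\sum_{x',x''\in X,\ x'+x''=x}g(x')h(x'')\qquad(x\in X).$$ Its unit element is $u$ with $u(0)=1$ and $u(x)=0$ for $x\neq0$; $g^{*j}$ is the $j$-fold convolution power, $g^{*0}=u$. For $x=(x_1,\ldots,x_k)\in\mathbb{R}^k$ let $|x|=|x_1|+\cdots+|x_k|$. For $r\in\mathbb{R}$, $\mathscr{A}_r$ is the set of $g\in\mathscr{A}$ with $\|g\|_r:=\sum_{x\in X}|g(x)|e^{-r|x|}<\infty$, and $\mathscr{A}_\infty:=\bigcup_{r\in\mathbb{R}}\mathscr{A}_r$.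 *)

(* Defs.v *)
From HB Require Import structures.
From mathcomp Require Import all_boot all_order all_algebra.
From mathcomp Require Import all_classical all_reals all_analysis.
From mathcomp Require Import complex.

Set Implicit Arguments.
Unset Strict Implicit.
Unset Printing Implicit Defensive.

Import Order.TTheory GRing.Theory Num.Theory.
Import numFieldNormedType.Exports.

Local Open Scope classical_set_scope.
Local Open Scope ring_scope.
Local Open Scope complex_scope.

Section DirichletAlgebra.
Variables (R : realType) (k : nat) (X : set 'rV[R]_k).

Definition l1norm (x : 'rV[R]_k) : R := \sum_(i < k) `|x ord0 i|.

(* The underlying space of the algebra is [X -> R[i]], with the pointwise
   linear structure. If [X] is discrete and contained in [0, oo)^k, every [x]
   has finitely many decompositions, so the finitely supported sum below ranges
   over all of them; it would be 0 only if infinitely many terms were nonzero. *)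
Definition dconv (g h : X -> R[i]) : X -> R[i] := fun x =>
  \sum_(p \in [set p : X * X | \val p.1 + \val p.2 = \val x]) (g p.1 * h p.2).

Definition dunit : X -> R[i] := fun x => (\val x == 0)%:R.

Definition dpow (g : X -> R[i]) (j : nat) : X -> R[i] :=
  iter j (dconv g) dunit.

Definition weighted_norm (r : R) (g : X -> R[i]) : \bar R :=
  \esum_(x in [set: X])
    (ComplexField.Normc.normc (g x) * expR (- r * l1norm (\val x)))%:E.

Definition Ainfty : set (X -> R[i]) :=
  [set g | exists r : R, (weighted_norm r g < +oo)%E].

Definition poly_op (d : nat) (a : 'I_d.+1 -> X -> R[i]) (g : X -> R[i]) :
    X -> R[i] :=
  \sum_(j < d.+1) dconv (a j) (dpow g j).

Definition zero_elt (X0 : X 0) : X := SigSub (mem_set X0).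

Definition poly_at0 (X0 : X 0) (d : nat) (a : 'I_d.+1 -> X -> R[i]) :
    {poly R[i]} :=
  \sum_(j < d.+1) (a j (zero_elt X0))%:P * 'X^j.

End DirichletAlgebra.

(* Main.v *)
Require Import Defs.
From HB Require Import structures.
From mathcomp Require Import all_boot all_order all_algebra.
From mathcomp Require Import all_classical all_reals all_analysis.
From mathcomp Require Import complex.
From mathcomp Require Import ring lra.

Set Implicit Arguments.
Unset Strict Implicit.
Unset Printing Implicit Defensive.

Import Order.TTheory GRing.Theory Num.Theory.
Import numFieldNormedType.Exports.
Import ComplexField.Normc.

Local Open Scope classical_set_scope.
Local Open Scope ring_scope.
Local Open Scope complex_scope.

(** Write [g = z0 u + h], where [u] is the unit and [h] vanishes at 0. As
    functions [X -> R[i]] with convolution form a commutative ring, the operator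
    [T] is a polynomial over this ring, and expanding it at [z0 u] gives
      [T (z0 u + h) = b0 + b1 * h + q(h) * h * h],
    where [b0] vanishes at 0 because [z0] is a zero of [f], and [b1] takes at 0
    the value [b = f'(z0)], which is nonzero because the zero is simple. Hence
    [T (z0 u + h) = 0] says that [h] is a fixed point of
      [chord h = h - b^-1 T (z0 u + h)
               = - b^-1 (b0 + (b1 - b u) * h + q(h) * h * h)],
    Newton's method with the slope frozen at [b]. Iterate it from [h = 0].

    - The iterates stabilize pointwise. Two arguments vanishing at 0 have images
      differing by their difference times an element [m] with [m 0 = 0]
      ([chord_diff]). Nonzero elements of [X] have l1 norm at least some [e > 0]
      ([deg_gap]), so multiplication by [m] raises by [e] the level below which
      a function vanishes ([vanish_belowM]): consecutive iterates [n] and [n + 1]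
      agree below [n e]. The pointwise limit therefore exists, and it is a zero
      of [T] because [T] does not see values at larger l1 norm.

    - For [r] large the iterates stay in a fixed ball of the norm with exponent
      [r] ([chord_ball]). A function vanishing at 0 becomes arbitrarily small in
      this norm as [r] grows ([norm_le_small]); this applies to [b0] and to
      [b1 - b u], while [q(h) * h * h] is quadratically small in the radius.
      Every finite part of the limit is a part of some iterate, so the limit
      lies in the same ball.

    Discreteness of [X] enters through the finiteness of its balls
    ([locally_finite]): it provides the gap [e] and the finite
    convolution sums. *)

(** * Locally finite semigroups in the positive orthant *)

Record dsemigroup (R : realType) (k : nat) := DSemigroup {
  ds_set :> set 'rV[R]_k;
  ds_ge0 : forall x, ds_set x -> forall i : 'I_k, 0 <= x ord0 i;
  ds_add : forall x y, ds_set x -> ds_set y -> ds_set (x + y);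
  ds_0 : ds_set 0;
  ds_fin : forall M : R, finite_set [set x : ds_set | l1norm (\val x) <= M] }.

Section Semigroup.
Variables (R : realType) (k : nat) (X : dsemigroup R k).
Implicit Types x y z : X.

Lemma val_ds x : (X : set _) (\val x).
Proof. by case: x => x /= /set_mem. Qed.

Definition deg x : R := l1norm (\val x).
Definition addX x y : X := SigSub (mem_set (ds_add (val_ds x) (val_ds y))).
Definition zeroX : X := zero_elt (ds_0 X).

Lemma deg_ge0 x : 0 <= deg x.
Proof. exact: sumr_ge0. Qed.

Lemma degD x y : deg (addX x y) = deg x + deg y.
Proof.
rewrite -big_split /=; apply: eq_bigr => i _; rewrite mxE !ger0_norm //.
- exact: (ds_ge0 (val_ds y)).
- exact: (ds_ge0 (val_ds x)).
- by apply: addr_ge0; [exact: (ds_ge0 (val_ds x))|exact: (ds_ge0 (val_ds y))].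
Qed.

Lemma addX0 x : addX x zeroX = x.
Proof. by apply: val_inj; rewrite /= addr0. Qed.

Lemma addXC x y : addX x y = addX y x.
Proof. by apply: val_inj; rewrite /= addrC. Qed.

Lemma addXA x y z : addX x (addX y z) = addX (addX x y) z.
Proof. by apply: val_inj; rewrite /= addrA. Qed.

Lemma deg_zero : deg zeroX = 0.
Proof. by rewrite /deg /l1norm big1 // => i _; rewrite mxE normr0. Qed.

(** All the convolution sums at points of norm at most [M] can be written over
    this one list, so that they can be exchanged as finite sums over fixed
    ranges. *)
Definition lower (M : R) : seq X :=
  finmap.enum_fset (fset_set [set x : X | deg x <= M]).

Lemma mem_lower M x : (x \in lower M) = (deg x <= M).
Proof.
rewrite [LHS](in_fset_set (ds_fin X M)).
by apply/idP/idP => [/set_mem //|?]; apply/mem_set.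
Qed.

Lemma lower_uniq M : uniq (lower M).
Proof. exact: finmap.fset_uniq. Qed.

Lemma deg_le0 x : deg x <= 0 -> x = zeroX.
Proof.
move=> x0; apply/val_inj/rowP => i /=; rewrite mxE; apply/eqP.
have /eqP : deg x = 0 by apply/eqP; rewrite eq_le x0 deg_ge0.
rewrite psumr_eq0 // => /allP/(_ i).
by rewrite mem_index_enum normr_eq0; apply.
Qed.

(** Only finitely many elements have norm at most 1, so the nonzero ones among
    them stay away from 0. *)
Lemma deg_gap : exists2 e : R, 0 < e & forall x, x != zeroX -> e <= deg x.
Proof.
suff [e e0 He] : exists2 e : R, 0 < e &
    forall x, x \in lower 1 -> x != zeroX -> e <= deg x.
  exists (Num.min e 1); first by rewrite lt_min e0 ltr01.
  move=> x xn0; rewrite ge_min; case: (leP (deg x) 1) => x1.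
    by rewrite He // mem_lower.
  by rewrite (ltW x1) orbT.
elim: (lower 1) => [|y s [e e0 He]]; first by exists 1.
have [->|yn0] := eqVneq y zeroX.
  exists e => // x; rewrite inE => /orP[/eqP ->|]; last exact: He.
  by rewrite eqxx.
have ys : 0 < deg y.
  by rewrite ltNge; apply: contra yn0 => /deg_le0 ->.
exists (Num.min e (deg y)); first by rewrite lt_min e0 ys.
move=> x; rewrite inE => /orP[/eqP -> _|xs xn0]; rewrite ge_min ?lexx ?orbT //.
by rewrite He.
Qed.

(** * The convolution ring *)

(** Both terms of a decomposition of [x] have norm at most that of [x], hence
    lie in [lower M]. The free choice of [M] permits the same range for the inner
    and the outer sum of an iterated convolution. *)
Lemma dconvE (M : R) (g h : X -> R[i]) x : deg x <= M ->
  dconv g h x =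
  \sum_(y <- lower M) \sum_(z <- lower M) (addX y z == x)%:R * (g y * h z).
Proof.
move=> xM; rewrite /dconv.
pose r := [seq p <- [seq (y, z) | y <- lower M, z <- lower M] | addX p.1 p.2 == x].
rewrite (@fsbigE _ _ _ _ _ r).
- rewrite (eq_bigl (fun p => addX p.1 p.2 == x)) => [|p]; last first.
    by apply/idP/eqP => [/set_mem /= H|<-]; [exact: val_inj|apply/mem_set].
  rewrite big_filter_cond (eq_bigl (fun p => addX p.1 p.2 == x)) => [|p].
    rewrite big_mkcond big_allpairs; apply: eq_bigr => y _; apply: eq_bigr => z _.
    by case: eqP; rewrite (mul1r, mul0r).
  by rewrite andbb.
- by rewrite filter_uniq // allpairs_uniq ?lower_uniq // => -[? ?] [? ?].
- by move=> p; rewrite /= mem_filter => /andP[/eqP/(congr1 val)].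
- move=> [y z] /= yz; rewrite mem_filter negb_and => /orP[/eqP[]|/negP[]].
    exact: val_inj.
  have E : addX y z = x by apply: val_inj.
  move: xM; rewrite -E degD => H.
  apply/allpairsP; exists (y, z); rewrite !mem_lower.
  have := deg_ge0 y; have := deg_ge0 z; split => //=; lra.
Qed.

(** The hypothesis covers the intermediate points of an iterated convolution:
    those outside [lower M] do not contribute. *)
Lemma big_lower_delta M x0 (F : X -> R[i]) : (M < deg x0 -> F x0 = 0) ->
  \sum_(p <- lower M) (x0 == p)%:R * F p = F x0.
Proof.
move=> F0; have [x0M|/F0 Fx0] := leP (deg x0) M; last first.
  rewrite big1 // => p _; case: eqP => [<-|_]; by rewrite ?Fx0 ?mulr0 ?mul0r.
rewrite (bigD1_seq x0) ?mem_lower ?lower_uniq //= eqxx mul1r.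
rewrite big1 ?addr0 // => i; rewrite eq_sym => /negPf ->; exact: mul0r.
Qed.

Lemma dconvC (g h : X -> R[i]) : dconv g h = dconv h g.
Proof.
apply/funext => x; rewrite !(dconvE _ _ (lexx (deg x))) exchange_big /=.
by apply: eq_bigr => y _; apply: eq_bigr => z _; rewrite addXC (mulrC (g z)).
Qed.

Lemma dunitE x : @dunit R k X x = (zeroX == x)%:R.
Proof. by rewrite /dunit eq_sym -(inj_eq val_inj). Qed.

Lemma dconv1 (g : X -> R[i]) : dconv (@dunit R k X) g = g.
Proof.
apply/funext => x; rewrite (dconvE _ _ (lexx (deg x))) exchange_big /=.
rewrite -[RHS](big_lower_delta (M := deg x)) ?ltxx //.
apply: eq_bigr => z _.
under eq_bigr => y _ do rewrite dunitE mulrCA.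
rewrite big_lower_delta; last by rewrite deg_zero ltNge deg_ge0.
by rewrite addXC addX0 eq_sym.
Qed.

(** Summing over the intermediate point [w = z + t] leaves a sum over triples
    with [y + (z + t) = x], from which associativity is read off. *)
Lemma dconv3E (g h l : X -> R[i]) x (L := lower (deg x)) :
  dconv g (dconv h l) x = \sum_(y <- L) \sum_(z <- L) \sum_(t <- L)
    (addX y (addX z t) == x)%:R * (g y * (h z * l t)).
Proof.
rewrite (dconvE _ _ (lexx (deg x))) -/L; apply: eq_bigr => y _.
transitivity (\sum_(w <- L) \sum_(z <- L) \sum_(t <- L)
   (addX z t == w)%:R * ((addX y w == x)%:R * (g y * (h z * l t)))).
  apply: eq_big_seq => w; rewrite mem_lower => /dconvE ->; rewrite -/L.
  rewrite !mulr_sumr; apply: eq_bigr => z _.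
  rewrite !mulr_sumr; apply: eq_bigr => t _; ring.
rewrite exchange_big /=; apply: eq_bigr => z _.
rewrite exchange_big /=; apply: eq_bigr => t _.
rewrite big_lower_delta // => H; case: eqP => [E|]; last by rewrite mul0r.
exfalso; move: H; rewrite -E degD; have := deg_ge0 y; lra.
Qed.

Lemma dconvA (g h l : X -> R[i]) : dconv g (dconv h l) = dconv (dconv g h) l.
Proof.
rewrite (dconvC (dconv g h)) (dconvC g h); apply/funext => x; rewrite !dconv3E.
rewrite [RHS]exchange_big /=.
under [RHS]eq_bigr => z _ do rewrite exchange_big.
rewrite [RHS]exchange_big /=; apply: eq_bigr => y _; apply: eq_bigr => z _.
apply: eq_bigr => t _; rewrite (addXC z y) (addXC t) addXA; ring.
Qed.

Lemma dconvDl (g h l : X -> R[i]) : dconv (g + h) l = dconv g l + dconv h l.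
Proof.
apply/funext => x; rewrite !fctE !(dconvE _ _ (lexx (deg x))).
rewrite -big_split /=; apply: eq_bigr => y _.
by rewrite -big_split /=; apply: eq_bigr => z _; rewrite mulrDl mulrDr.
Qed.

Lemma dconv_at0 (g h : X -> R[i]) : dconv g h zeroX = g zeroX * h zeroX.
Proof.
rewrite (dconvE _ _ (lexx (deg zeroX))).
rewrite -[in RHS](big_lower_delta (M := deg zeroX) (F := g)) ?ltxx //.
rewrite mulr_suml; apply: eq_big_seq => y; rewrite mem_lower deg_zero.
move=> /deg_le0 ->; rewrite eqxx mul1r.
rewrite -[in RHS](big_lower_delta (M := 0) (F := h)) ?deg_zero ?ltxx //.
rewrite mulr_sumr; apply: eq_big_seq => z; rewrite mem_lower.
by move=> /deg_le0 ->; rewrite addX0 eqxx !mul1r.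
Qed.

Lemma dconv_vanish (s t : R) (g h : X -> R[i]) :
  (forall x, deg x < s -> g x = 0) -> (forall x, deg x < t -> h x = 0) ->
  forall x, deg x < s + t -> dconv g h x = 0.
Proof.
move=> g0 h0 x xst; rewrite (dconvE _ _ (lexx (deg x))).
rewrite big1 // => y _; rewrite big1 // => z _.
case: eqP => [E|]; last by rewrite mul0r.
have [/g0 ->|ys] := ltP (deg y) s; first by rewrite mul0r mulr0.
rewrite h0 ?mulr0 //; move: xst; rewrite -E degD; lra.
Qed.
End Semigroup.

(** A name apart from the plain function type, whose pointwise product would
    otherwise compete with the convolution. *)
Definition dalg (R : realType) (k : nat) (X : dsemigroup R k) := X -> R[i].

Section Ring.
Variables (R : realType) (k : nat) (X : dsemigroup R k).

HB.instance Definition _ := GRing.Zmodule.on (dalg X).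

Lemma dunit_neq0 : (@dunit R k X : dalg X) != 0.
Proof.
apply/eqP => /(congr1 (fun g => g (zeroX X))).
by rewrite dunitE eqxx => /eqP; rewrite oner_eq0.
Qed.

HB.instance Definition _ := GRing.Zmodule_isComNzRing.Build (dalg X)
  (@dconvA _ _ X) (@dconvC _ _ X) (@dconv1 _ _ X) (@dconvDl _ _ X) dunit_neq0.

Definition ev0 (g : dalg X) : R[i] := g (zeroX X).

Fact ev0_is_zmod_morphism : zmod_morphism ev0. Proof. by []. Qed.
Fact ev0_is_monoid_morphism : monoid_morphism ev0.
Proof. by split; [rewrite /ev0 [LHS]dunitE eqxx|exact: dconv_at0]. Qed.

HB.instance Definition _ := GRing.isZmodMorphism.Build (dalg X) R[i] ev0
  ev0_is_zmod_morphism.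
HB.instance Definition _ := GRing.isMonoidMorphism.Build (dalg X) R[i] ev0
  ev0_is_monoid_morphism.

Lemma dpowE (g : dalg X) n : dpow g n = g ^+ n :> dalg X.
Proof. by elim: n => [//|n IH]; rewrite exprS -IH. Qed.

End Ring.

(** * Weighted norms *)
Section Norm.
Variables (R : realType) (k : nat) (X : dsemigroup R k).
Implicit Types (x y z : X) (g h : dalg X) (r C D : R).

(** The weight is multiplicative along [addX] because the l1 norm is additive on
    the positive orthant; this makes the weighted norm submultiplicative. *)
Definition wt r x : R := expR (- r * deg x).

(** The weighted norm is at most [C], through its finite partial sums: they stay
    in [R], and they are what passes to a pointwise limit. *)
Definition norm_le r g C := forall s : seq X, uniq s ->
  \sum_(x <- s) normc (g x) * wt r x <= C.

Lemma normc_ge0 (c : R[i]) : 0 <= normc c.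
Proof. by case: c => a b; exact: sqrtr_ge0. Qed.

Lemma normc_sum (I : Type) (s : seq I) (F : I -> R[i]) :
  normc (\sum_(j <- s) F j) <= \sum_(j <- s) normc (F j).
Proof.
elim: s => [|j s IH]; first by rewrite !big_nil normc0.
by rewrite !big_cons (le_trans (le_normcD _ _)) // lerD2l.
Qed.

Lemma wt_ge0 r x : 0 <= wt r x.
Proof. exact: expR_ge0. Qed.

Lemma term_ge0 r g x : 0 <= normc (g x) * wt r x.
Proof. by rewrite mulr_ge0 ?wt_ge0 ?normc_ge0. Qed.

Lemma wtD r x y : wt r (addX x y) = wt r x * wt r y.
Proof. by rewrite /wt -expRD degD mulrDr. Qed.

Lemma norm_le_ge0 r g C : norm_le r g C -> 0 <= C.
Proof. by move=> /(_ [::] isT); rewrite big_nil. Qed.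

Lemma norm_leW r g C D : C <= D -> norm_le r g C -> norm_le r g D.
Proof. by move=> CD gC s us; exact: le_trans (gC s us) CD. Qed.

Lemma norm_leD r g h C D :
  norm_le r g C -> norm_le r h D -> norm_le r (g + h) (C + D).
Proof.
move=> gC hD s us; apply: le_trans (lerD (gC s us) (hD s us)).
rewrite -big_split /=; apply: ler_sum => x _.
by rewrite -mulrDl ler_wpM2r ?wt_ge0 // le_normcD.
Qed.

Lemma norm_le0 r C : 0 <= C -> norm_le r 0 C.
Proof.
move=> C0 s _; rewrite big1 // => x _.
by rewrite -[LHS]/(normc (0 : R[i]) * _) normc0 mul0r.
Qed.

Lemma norm_leN r g C : norm_le r g C -> norm_le r (- g) C.
Proof.
move=> gC s us; apply: le_trans (gC s us).
by apply: ler_sum => x _; rewrite -normcN opprK.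
Qed.

Lemma deg_ub_seq (s : seq X) : exists M, forall x, x \in s -> deg x <= M.
Proof.
exists (\sum_(x <- s) deg x) => x xs.
by rewrite (big_rem x) //= lerDl sumr_ge0 // => y _; exact: deg_ge0.
Qed.

(** With [L] containing all terms of decompositions of points of [s], the sum
    over [s] counts each pair of [L x L] at most once, so it is bounded by the
    product of the two partial sums over [L]. *)
Lemma norm_leM r g h C D :
  norm_le r g C -> norm_le r h D -> norm_le r (g * h) (C * D).
Proof.
move=> gC hD s us; have [M sM] := deg_ub_seq s; pose L := lower X M.
pose G x := normc (g x) * wt r x; pose H x := normc (h x) * wt r x.
have le1 y z : \sum_(x <- s) (addX y z == x)%:R <= 1 :> R.
  have [ins|nins] := boolP (addX y z \in s).
    rewrite (bigD1_seq (addX y z)) //= eqxx big1 ?addr0 // => x.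
    by rewrite eq_sym => /negPf ->.
  by rewrite big_seq big1 // => x xs; case: eqP nins => // ->; rewrite xs.
apply: (@le_trans _ _ (\sum_(y <- L) \sum_(z <- L)
    (\sum_(x <- s) (addX y z == x)%:R) * (G y * H z))).
  under [leRHS]eq_bigr => y _ do under eq_bigr => z _ do rewrite mulr_suml.
  under [leRHS]eq_bigr => y _ do rewrite exchange_big.
  rewrite [leRHS]exchange_big /= big_seq [leRHS]big_seq.
  apply: ler_sum => x xs; rewrite [(g * h) x](dconvE _ _ (sM x xs)) -/L.
  rewrite (le_trans (ler_wpM2r (wt_ge0 r x) (normc_sum _ _))) //.
  rewrite mulr_suml; apply: ler_sum => y _.
  rewrite (le_trans (ler_wpM2r (wt_ge0 r x) (normc_sum _ _))) //.
  rewrite mulr_suml; apply: ler_sum => z _.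
  case: eqP => [<-|_]; last by rewrite !mul0r normc0 mul0r.
  by rewrite !mul1r normcM wtD mulrACA.
apply: (@le_trans _ _ ((\sum_(y <- L) G y) * (\sum_(z <- L) H z))).
  rewrite mulr_suml; apply: ler_sum => y _; rewrite mulr_sumr.
  by apply: ler_sum => z _; rewrite ler_piMl // mulr_ge0 ?term_ge0.
by apply: ler_pM; rewrite ?sumr_ge0 ?gC ?hD ?lower_uniq // => ? _; exact: term_ge0.
Qed.

Lemma norm_le_mono r r' g C : r <= r' -> norm_le r g C -> norm_le r' g C.
Proof.
move=> rr' gC s us; apply: le_trans (gC s us); apply: ler_sum => x _.
by rewrite ler_wpM2l ?normc_ge0 // ler_expR ler_wpM2r ?deg_ge0 // lerN2.
Qed.

Definition cst (c : R[i]) : dalg X := fun x => c * dunit x.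

Lemma cst_mulE c g x : (cst c * g) x = c * g x.
Proof.
rewrite -[in RHS](mul1r g) [(cst c * g) x](dconvE _ _ (lexx (deg x))).
rewrite [(1 * g) x](dconvE _ _ (lexx (deg x))) mulr_sumr.
apply: eq_bigr => y _; rewrite mulr_sumr; apply: eq_bigr => z _.
by rewrite /cst -!mulrA mulrCA.
Qed.

Lemma cst1 : cst 1 = 1.
Proof. by apply/funext => x; rewrite /cst mul1r. Qed.

Lemma cstM c d : cst c * cst d = cst (c * d).
Proof. by apply/funext => x; rewrite cst_mulE /cst mulrA. Qed.

Lemma ev0_cst c : ev0 (cst c) = c.
Proof. by rewrite /ev0 /cst dunitE eqxx mulr1. Qed.

Lemma norm_le_cst r c : norm_le r (cst c) (normc c).
Proof.
move=> s us; have [ins|nins] := boolP (zeroX X \in s); last first.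
  rewrite big_seq big1 ?normc_ge0 // => x xs; rewrite /cst dunitE.
  by case: eqP nins => [->|_ _]; rewrite ?xs // mulr0 normc0 mul0r.
rewrite (bigD1_seq (zeroX X)) //= [X in _ + X]big1 ?addr0 => [|x].
  by rewrite /cst dunitE eqxx mulr1 /wt deg_zero mulr0 expR0 mulr1.
by rewrite eq_sym /cst dunitE => /negPf ->; rewrite mulr0 normc0 mul0r.
Qed.

(** Raising the exponent by [t] multiplies each term away from 0 by at most
    [exp (- t d)], where [d] is the gap of [X]; then [t] is chosen large. *)
Lemma norm_le_small r g C (e : R) : norm_le r g C -> ev0 g = 0 -> 0 < e ->
  exists r1, forall r', r1 <= r' -> norm_le r' g e.
Proof.
move=> gC g0 e0; have [d d0 gap] := deg_gap X.
have C0 := norm_le_ge0 gC.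
pose t := C / e / d.
have t0 : 0 <= t by rewrite !divr_ge0 // ltW.
exists (r + t) => r' rr'; apply: (norm_le_mono rr') => s us.
have K : C * expR (- (t * d)) <= e.
  rewrite expRN -[leRHS]divr1 ler_pdivrMr ?expR_gt0 // mulrAC.
  rewrite divr1 -ler_pdivrMl // mulrC.
  by rewrite divfK ?gt_eqF // (le_trans _ (expR_ge1Dx _)) // lerDr.
apply: le_trans K; rewrite mulrC.
apply: le_trans (ler_wpM2l (expR_ge0 _) (gC s us)).
rewrite mulr_sumr; apply: ler_sum => x _.
have [->|xn0] := eqVneq x (zeroX X).
  by rewrite [g _]g0 normc0 !mul0r mulr0.
rewrite mulrCA ler_wpM2l ?normc_ge0 // /wt -expRD ler_expR.
by have := ler_wpM2l t0 (gap x xn0); lra.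
Qed.

(** A boolean predicate, so that closure of polynomial coefficients can be
    inferred from the subring structure. *)
Definition Ainf : {pred dalg X} := fun g => `[< exists r C, norm_le r g C >].

Lemma AinfP g : reflect (exists r C, norm_le r g C) (g \in Ainf).
Proof. exact: asboolP. Qed.

Lemma Ainf_cst c : cst c \in Ainf.
Proof. by apply/AinfP; exists 0, (normc c); exact: norm_le_cst. Qed.

Lemma Ainf_common g h : g \in Ainf -> h \in Ainf ->
  exists r C D, norm_le r g C /\ norm_le r h D.
Proof.
move=> /AinfP[r [C gC]] /AinfP[r' [D hD]].
exists (Num.max r r'), C, D.
by split; [apply: norm_le_mono gC|apply: norm_le_mono hD]; rewrite le_max lexx ?orbT.
Qed.

Fact Ainf_subring : subring_closed Ainf.
Proof.
split=> [|g h gA hA|g h gA hA]; first by rewrite -cst1 Ainf_cst.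
  have [r [C [D [gC hD]]]] := Ainf_common gA hA.
  by apply/AinfP; exists r, (C + D); apply: norm_leD gC (norm_leN hD).
have [r [C [D [gC hD]]]] := Ainf_common gA hA.
by apply/AinfP; exists r, (C * D); exact: norm_leM.
Qed.
HB.instance Definition _ := GRing.isSubringClosed.Build (dalg X) Ainf Ainf_subring.

(** The bound is uniform in the exponent and over the unit ball; this controls
    the quadratic remainder of the Taylor expansion. *)
Lemma norm_le_horner (q : {poly dalg X}) : q \is a polyOver Ainf ->
  exists r0 D, forall r h, r0 <= r -> norm_le r h 1 -> norm_le r q.[h] D.
Proof.
rewrite qualifE /= /horner; elim: (q : seq _) => [_|c s IH /= /andP[cA sA]].
  by exists 0, 0 => r h _ _; exact: norm_le0.
have [r0 [D sD]] := IH sA; have /AinfP[r1 [C cC]] := cA.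
exists (Num.max r0 r1), (D * 1 + C) => r h; rewrite ge_max => /andP[r0r r1r] h1.
by apply: norm_leD (norm_le_mono r1r cC); apply: norm_leM (h1); exact: sD.
Qed.

End Norm.
Arguments Ainf {R k X}.

(** * Second-order Taylor expansion *)
Section Taylor.
Variables (A : comNzRingType) (p : {poly A}) (z : A).

(** A polynomial rather than a function of the increment, so that it can be
    bounded: its coefficients lie in every subring that contains [z] and the
    coefficients of [p]. *)
Definition taylor2 : {poly A} := drop_poly 2 (p \Po ('X + z%:P)).

Lemma horner_taylor2 e :
  p.[z + e] = p.[z] + p^`().[z] * e + taylor2.[e] * (e * e).
Proof.
have -> : p.[z + e] = (p \Po ('X + z%:P)).[e].
  by rewrite horner_comp !hornerE addrC.
rewrite -[in LHS](poly_take_drop 2 (p \Po _)) hornerD hornerM hornerXn expr2.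
congr (_ + _); rewrite /take_poly horner_poly !big_ord_recl big_ord0 addr0.
rewrite expr0 mulr1 expr1; congr (_ + _ * _).
  by rewrite -horner_coef0 horner_comp !hornerE.
rewrite /= /bump /= -[LHS]mulr1n -coef_deriv -horner_coef0 deriv_comp.
by rewrite hornerM horner_comp derivD derivX derivC !hornerE.
Qed.

End Taylor.

(** * The chord iteration *)
Section Chord.
Variables (R : realType) (k : nat) (X : dsemigroup R k).
Variables (p : {poly dalg X}) (z0 : R[i]).
Hypothesis pA : p \is a polyOver Ainf.
Let f := map_poly (@ev0 R k X) p.
Let b := f^`().[z0].
Hypothesis f0 : f.[z0] = 0.
Hypothesis b0 : b != 0.

Let z : dalg X := cst z0.
Let chord (h : dalg X) : dalg X := h - cst b^-1 * p.[z + h].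

Definition vanish_below (t : R) (g : dalg X) := forall x, deg x < t -> g x = 0.

(** A point of norm less than [s + t] only decomposes into pairs whose first term
    is below [s] or whose second term is below [t]. *)
Lemma vanish_belowM s t g h :
  vanish_below s g -> vanish_below t h -> vanish_below (s + t) (g * h).
Proof. exact: dconv_vanish. Qed.

Lemma vanish_below0 g : vanish_below 0 g.
Proof. by move=> x; rewrite ltNge deg_ge0. Qed.

Lemma vanish_belowB t g h :
  vanish_below t g -> vanish_below t h -> vanish_below t (g - h).
Proof.
move=> g0 h0 x xt; have -> : (g - h) x = g x - h x by [].
by rewrite (g0 x xt) (h0 x xt) subrr.
Qed.

Let ev0_z h : ev0 h = 0 -> ev0 (z + h) = z0.
Proof. by move=> h0; rewrite raddfD /= h0 addr0 ev0_cst. Qed.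

(** Expand at [z + h]: the quotient is [p'(z + h)] plus a multiple of [h' - h],
    and only the former survives at 0. *)
Lemma horner_diff_factor h h' : ev0 h = 0 -> ev0 h' = 0 ->
  exists2 m, ev0 m = b & p.[z + h'] - p.[z + h] = m * (h' - h).
Proof.
move=> h0 h'0; pose e := h' - h.
have e0 : ev0 e = 0 by rewrite raddfB /= h0 h'0 subr0.
exists (p^`().[z + h] + (taylor2 p (z + h)).[e] * e).
  rewrite rmorphD rmorphM /= e0 mulr0 addr0 -horner_map /= -deriv_map.
  by rewrite ev0_z.
have -> : z + h' = (z + h) + e by rewrite /e; ring.
by rewrite horner_taylor2 -/e; ring.
Qed.

(** The slope [b] of [chord] is the value at 0 of the difference quotient, so the
    two cancel there. *)
Lemma chord_diff h h' : ev0 h = 0 -> ev0 h' = 0 ->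
  exists2 m, ev0 m = 0 & chord h' - chord h = m * (h' - h).
Proof.
move=> h0 h'0; have [m m0 E] := horner_diff_factor h0 h'0.
exists (1 - cst b^-1 * m).
  by rewrite rmorphB rmorphM rmorph1 /= ev0_cst m0 mulVf // subrr.
by rewrite mulrBl mul1r -mulrA -E /chord; ring.
Qed.

Lemma ev0_chord h : ev0 h = 0 -> ev0 (chord h) = 0.
Proof.
move=> h0; rewrite /chord rmorphB rmorphM /= -horner_map /= ev0_z // -/f f0.
by rewrite mulr0 h0 subr0.
Qed.

(** Writing [chord h = - b^-1 (b0 + b1' h + q(h) h h)] with [b0] and [b1']
    vanishing at 0, the image has norm at most
    [(e + e rho + D rho^2) / |b|], where [e] is as small as wanted for a large
    exponent. A radius [rho <= 1] with [D rho <= |b| / 2] together with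
    [e = |b| rho / 4] brings this below [rho]. *)
Lemma chord_ball : exists r rho,
  0 <= rho /\ forall h, norm_le r h rho -> norm_le r (chord h) rho.
Proof.
have b00 : ev0 p.[z] = 0.
  by rewrite -horner_map /= ev0_cst.
have b10 : ev0 (p^`().[z] - cst b) = 0.
  by rewrite rmorphB /= -horner_map /= !ev0_cst -deriv_map subrr.
have zA : z \in Ainf by exact: Ainf_cst.
have b0A : p.[z] \in Ainf by exact: rpred_horner.
have b1A : p^`().[z] - cst b \in Ainf.
  by rewrite rpredB ?Ainf_cst // rpred_horner // polyOver_deriv.
have qA : taylor2 p z \is a polyOver Ainf.
  apply/polyOverP => i; rewrite coef_drop_poly.
  move: (i + 2)%N; apply/polyOverP.
  by rewrite polyOver_comp // rpredD ?polyOverX ?polyOverC.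
have [r0 [D qD]] := norm_le_horner qA.
have B0 : 0 < normc b.
  by rewrite lt_neqAle normc_ge0 andbT eq_sym; apply: contra b0 => /eqP/eq0_normc ->.
set B := normc b in B0.
(* [D] may be zero, and the radius divides by it. *)
pose D' := Num.max D 1.
pose rho := Num.min 1 (B / (D' * 2)).
have D'0 : 0 < D' by rewrite lt_max ltr01 orbT.
have rho0 : 0 < rho by rewrite lt_min ltr01 divr_gt0 // mulr_gt0.
have rho1 : rho <= 1 by rewrite ge_min lexx.
have e0 : 0 < B * rho / 4 by rewrite divr_gt0 // mulr_gt0.
have /AinfP[s0 [C0 bC0]] := b0A; have /AinfP[s1 [C1 bC1]] := b1A.
have [r1 H1] := norm_le_small bC0 b00 e0.
have [r2 H2] := norm_le_small bC1 b10 e0.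
exists (Num.max r0 (Num.max r1 r2)), rho; split; first exact: ltW.
set r := Num.max _ _ => h hrho.
have r0r : r0 <= r by rewrite le_max lexx.
have r1r : r1 <= r by rewrite !le_max lexx orbT.
have r2r : r2 <= r by rewrite !le_max lexx !orbT.
have E : chord h = - (cst b^-1 *
   (p.[z] + (p^`().[z] - cst b) * h + (taylor2 p z).[h] * (h * h))).
  rewrite /chord horner_taylor2 -{1}[h]mul1r -cst1 -(mulVf b0) -cstM; ring.
rewrite E; apply/norm_leN.
have := norm_leM (norm_le_cst r b^-1)
  (norm_leD (norm_leD (H1 r r1r) (norm_leM (H2 r r2r) hrho))
  (norm_leM (qD r h r0r (norm_leW rho1 hrho)) (norm_leM hrho hrho))).
apply: norm_leW; rewrite normcV -/B ler_pdivrMl //.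
have : D * rho <= B / 2.
  apply: (@le_trans _ _ (D' * (B / (D' * 2)))).
    by rewrite (le_trans (ler_wpM2r (ltW rho0) (_ : D <= D'))) ?le_max ?lexx //
       ler_wpM2l ?(ltW D'0) // ge_min lexx orbT.
  by rewrite [leLHS](_ : _ = B / 2) //; field; rewrite gt_eqF.
move=> /(ler_wpM2r (ltW rho0)) H3.
have H4 : B * rho / 4 * rho <= B * rho / 4 by rewrite ler_piMr // ltW.
by move: H3 H4; lra.
Qed.

Let it n := iter n chord 0.

Let ev0_it n : ev0 (it n) = 0.
Proof. by elim: n => [|n IH]; [rewrite raddf0|exact: ev0_chord]. Qed.

(** The iterates from 0 agree from the index [n] on below the level [n d], where
    [d] is the gap of [X]; the solution takes at [x] the value of the first
    iterate known to have settled there. *)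
Lemma algebraic_solution : exists g, [/\ g \in Ainf, p.[g] = 0 & ev0 g = z0].
Proof.
have [d d0 gap] := deg_gap X.
have ev0_vanish g : ev0 g = 0 -> vanish_below d g.
  move=> g0 x; have [-> //|/gap] := eqVneq x (zeroX X).
  by rewrite leNgt => /negPf ->.
have stepP n : vanish_below (n%:R * d) (it n.+1 - it n).
  elim: n => [|n IH]; first by rewrite mul0r; exact: vanish_below0.
  have [m m0 E] := chord_diff (ev0_it n) (ev0_it n.+1).
  rewrite [it n.+2 - _]E mulrSr mulrDl mul1r addrC.
  by apply: vanish_belowM IH; exact: ev0_vanish.
have it_low n j x : deg x < n%:R * d -> it (n + j)%N x = it n x.
  move=> xn; elim: j => [|j <-]; first by rewrite addn0.
  rewrite addnS; apply/eqP; rewrite -subr_eq0; apply/eqP; apply: stepP.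
  by rewrite (lt_le_trans xn) // ler_wpM2r ?ler_nat ?leq_addr // ltW.
pose N (x : X) := (Num.truncn (deg x / d)).+1.
have NP x : deg x < (N x)%:R * d.
  by rewrite -ltr_pdivrMr // truncnS_gt.
pose h : dalg X := fun x => it (N x) x.
have hE n x : deg x < n%:R * d -> h x = it n x.
  move=> xn; rewrite /h -(it_low _ n _ (NP x)) addnC; exact: it_low.
have h0 : ev0 h = 0 by exact: (ev0_it (N (zeroX X))).
have [r [rho [rho0 ball]]] := chord_ball.
have it_bnd n : norm_le r (it n) rho.
  by elim: n => [|n IH]; [exact: norm_le0|exact: ball].
have hA : h \in Ainf.
  apply/AinfP; exists r, rho => s us.
  pose n := (\max_(x <- s) N x)%N.
  apply: le_trans (it_bnd n s us); rewrite big_seq [leRHS]big_seq.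
  apply: ler_sum => x xs; rewrite (@hE n) //.
  rewrite (lt_le_trans (NP x)) // ler_wpM2r ?(ltW d0) // ler_nat.
  exact: leq_bigmax_seq.
exists (z + h); split; [by rewrite rpredD ?Ainf_cst| |exact: ev0_z].
(* Near [x] the value of [p] is the sum of the error made by replacing the limit
   by the [n]-th iterate and of the residual of that iterate, and the residual
   is [- b] times the [n]-th increment. Both vanish below [n d]. *)
apply/funext => x; pose n := N x.
have [m _ E] := horner_diff_factor (ev0_it n) h0.
have -> : p.[z + h] = m * (h - it n) - cst b * (it n.+1 - it n).
  have -> : it n.+1 - it n = - (cst b^-1 * p.[z + it n]).
    by rewrite [it n.+1]/(chord (it n)) /chord; ring.
  by rewrite -E mulrN opprK mulrA cstM divff // cst1 mul1r subrK.
have lh : vanish_below (n%:R * d) (h - it n).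
  move=> y yn; have -> : (h - it n) y = h y - it n y by [].
  by rewrite (hE n y yn) subrr.
apply: (vanish_belowB (t := 0 + n%:R * d)).
- exact: vanish_belowM (vanish_below0 _) lh.
- exact: vanish_belowM (vanish_below0 _) (stepP n).
- by rewrite add0r NP.
Qed.

End Chord.

(** * Discreteness, simple zeros and the theorem *)
Lemma AinftyP (R : realType) (k : nat) (X : dsemigroup R k) (g : dalg X) :
  Ainfty g <-> g \in Ainf.
Proof.
split=> [[r gr]|/AinfP[r [C gC]]].
  apply/AinfP; exists r, (fine (weighted_norm r g)) => s us.
  have w0 : (0 <= weighted_norm r g)%E.
    by apply: esum_ge0 => x _; rewrite lee_fin term_ge0.
  rewrite -lee_fin fineK ?ge0_fin_numE // -sumEFin; apply: esum_ge.
  by exists [set` s]; [split; [exact: finite_seq|]|rewrite fsbig_seq].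
exists r; apply: le_lt_trans (ltry C).
apply: ge_ereal_sup => _ [A [finA _] <-].
by rewrite fsbig_finite // sumEFin lee_fin; apply: gC; exact: finmap.fset_uniq.
Qed.

(** Were a ball [E] of [X] infinite, the complements of finite sets would form
    a filter on [E]; a cluster point of it in a compact cube would be a
    limit point of [X]. *)
Lemma locally_finite (R : realType) (k : nat) (X : set 'rV[R]_k) :
  (forall x, ~ limit_point X x) ->
  forall M : R, finite_set [set x : X | l1norm (\val x) <= M].
Proof.
move=> Xdiscr M; pose E := [set x : 'rV[R]_k | X x /\ l1norm x <= M].
suff finE : finite_set E.
  apply: (@sub_finite_set _ _ (val @^-1` E)).
    by move=> [x Xx] /= xM; split => //; exact: set_mem.
  by apply: finite_preimage finE => x y _ _; exact: val_inj.
apply: contrapT => infE.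
pose F : set_system 'rV[R]_k := [set A | finite_set (E `\` A)].
have FF : ProperFilter F.
  split; first by rewrite /F /= setD0.
  split => [|A B|A B AB]; rewrite /F /=.
  - by rewrite setDT.
  - by rewrite setDIr finite_setU.
  - by apply: sub_finite_set; exact: setDS.
have cB := @rV_compact R k (fun=> `[- M, M]%classic) (fun=> @segment_compact _ _ _).
have [|p [_ clp]] := cB F.
  rewrite /F /= (_ : _ `\` _ = set0) //; apply/seteqP; split => // v [[_ vM]].
  case => i /=; rewrite in_itv /= -ler_norml; apply: le_trans vM.
  by rewrite /l1norm (bigD1 i) //= lerDl sumr_ge0.
apply: (Xdiscr p) => U Up.
have [|y [[Ey yp] Uy]] := clp (E `\ p) U _ Up.
  by rewrite /F /= setDD; apply: sub_finite_set (finite_set1 p) => y [].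
by exists y; split => //; [apply/eqP|case: Ey].
Qed.

Lemma simple_root (K : fieldType) (f : {poly K}) (c : K) :
  mup c f = 1%N -> f.[c] = 0 /\ f^`().[c] != 0.
Proof.
(* [mup] ranges over exponents at most [size f], so it is 0 at the zero
   polynomial. *)
move=> m1; have fn0 : f != 0.
  by apply/eqP => fE; have := ltn_ord [arg max_(n > ord0 : 'I_(size f).+1 |
    ('X - c%:P) ^+ n %| f) n]; rewrite -/(mup c f) m1 fE size_poly0.
have : root f c by apply: contraPT m1 => /mupNroot ->.
move=> fc; split; first exact/eqP.
have [q fE] := factor_theorem f c fc.
apply: contra_eqN m1 => f'c; rewrite eqn_leq negb_and mup_leq // negbK.
rewrite fE expr2 dvdp_mul2r ?polyXsubC_eq0 // dvdp_XsubCl rootE.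
move: f'c; rewrite fE derivM derivXsubC !hornerE subrr.
by rewrite mulr0 add0r => ->.
Qed.

Theorem theorem2 (R : realType) (k : nat) (hk : (0 < k)%N)
  (X : set 'rV[R]_k)
  (Xge0 : forall x, X x -> forall i : 'I_k, 0 <= x ord0 i)
  (XD : forall x y, X x -> X y -> X (x + y))
  (X0 : X 0)
  (Xinf : infinite_set X)
  (Xdiscrete : forall x : 'rV[R]_k, ~ limit_point X x)
  (d : nat) (hd : (0 < d)%N)
  (a : 'I_d.+1 -> X -> R[i])
  (aA : forall j, Ainfty (a j))
  (ad0 : a ord_max <> 0)
  (z0 : R[i])
  (z0_simple : mup z0 (poly_at0 X0 a) = 1%N) :
  exists g : X -> R[i],
    [/\ Ainfty g, poly_op a g = 0 & g (zero_elt X0) = z0].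
Proof.
pose S := DSemigroup Xge0 XD X0 (locally_finite Xdiscrete).
pose p : {poly dalg S} := \sum_(j < d.+1) (a j : dalg S)%:P * 'X^j.
have pA : p \is a polyOver Ainf.
  apply: rpred_sum => j _; rewrite rpredM ?rpredX ?polyOverX // polyOverC.
  exact/AinftyP/aA.
have pE : map_poly (@ev0 R k S) p = poly_at0 X0 a.
  rewrite rmorph_sum; apply: eq_bigr => j _ /=.
  by rewrite rmorphM /= map_polyC map_polyXn.
have [f0 f'0] := simple_root z0_simple.
rewrite -pE in f0 f'0.
have [g [gA pg0 g0]] := algebraic_solution pA f0 f'0.
exists g; split; [exact/(@AinftyP R k S)|rewrite -[RHS]pg0|exact: g0].
rewrite /poly_op horner_sum; apply: eq_bigr => j _.
by rewrite hornerM hornerC hornerXn -dpowE.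
Qed.
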